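(* Let $C_1,\ldots,C_N\subset\mathbb{R}^d$ be closed convex sets with nonempty intersection $C=C_1\cap\cdots\cap C_N$, and let $(\widetilde\beta^{(n)})_{n\ge1}$ be a sequence in $\mathcal{B}$. Assume that for any $m\in\mathbb{N}$, $m\ge1$, and any $x\in\mathbb{R}^d$ the sequence $$Q_{\widetilde\beta^{(n)}}Q_{\widetilde\beta^{(n-1)}}\cdots Q_{\widetilde\beta^{(m)}}(x)$$ is convergent to an element of $C$ as $n\to\infty$. Let $(\beta^{(n)})_{n\ge1}$ be a sequence in $\mathcal{B}$ satisfying $$\sum_{n=1}^\infty\sum_{i=1}^N|\beta_i^{(n)}-\widetilde\beta_i^{(n)}|<\infty .$$ Then for any $x\in\mathbb{R}^d$ the sequence $$Q_{\beta^{(n)}}Q_{\beta^{(n-1)}}\cdots Q_{\beta^{(1)}}(x)$$ is convergent to an element of $C$ as $n\to\infty$.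
   Context: For a nonempty closed convex set $D\subset\mathbb{R}^d$ (with Euclidean norm), $P_D$ is the (nearest point) projection onto $D$. The parameter set is $\mathcal{B}=\{\beta=(\beta_1,\ldots,\beta_N): \beta_i\ge 0 \text{ for all } i,\ \sum_{i=1}^N\beta_i\le 2\}$. For $\beta\in\mathcal{B}$ the operator $Q_\beta:\mathbb{R}^d\to\mathbb{R}^d$ is $Q_\beta=\mathrm{Id}-\sum_{j=1}^N\beta_j(\mathrm{Id}-P_{C_j})$, where $\mathrm{Id}$ is the identity. Products of the operators $Q_\beta$ denote composition. *)

(* Defs.v *)
(* R^d is the space of row vectors over an arbitrary realType R. *)
From mathcomp Require Import all_boot all_order all_algebra.
From mathcomp Require Import all_classical all_reals all_analysis.

Set Implicit Arguments.
Unset Strict Implicit.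
Unset Printing Implicit Defensive.

Import Order.TTheory GRing.Theory Num.Theory.
Import numFieldNormedType.Exports.

Local Open Scope classical_set_scope.
Local Open Scope ring_scope.

(* The norm `|x| of the library on 'rV[R]_d is the sup norm. It induces the
   usual topology of R^d, which is the one meant by `closed' and `-->', but
   nearest points are taken for the Euclidean norm. *)
Definition enorm (R : realType) (d : nat) (x : 'rV[R]_d) : R :=
  Num.sqrt (\sum_(k < d) x 0 k ^+ 2).

Definition is_nearest (R : realType) (d : nat) (D : set 'rV[R]_d)
    (x y : 'rV[R]_d) : Prop :=
  D y /\ forall z, D z -> enorm (x - y) <= enorm (x - z).

(* When D is nonempty, closed and convex, there is exactly one nearest point;
   `get' returns an arbitrary default value if there is none. *)
Definition proj (R : realType) (d : nat) (D : set 'rV[R]_d)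
    (x : 'rV[R]_d) : 'rV[R]_d :=
  [get y | is_nearest D x y].

Definition paramB (R : realType) (N : nat) : set 'rV[R]_N :=
  [set b | (forall i, 0 <= b 0 i) /\ \sum_(i < N) b 0 i <= 2].

Definition opQ (R : realType) (d N : nat) (C : 'I_N -> set 'rV[R]_d)
    (b : 'rV[R]_N) (x : 'rV[R]_d) : 'rV[R]_d :=
  x - \sum_(j < N) b 0 j *: (x - proj (C j) x).

(* Q_{b n} Q_{b (n-1)} ... Q_{b m} x, where Q_{b m} is applied first; this is
   the empty product, x, when n < m. *)
Definition prodQ (R : realType) (d N : nat) (C : 'I_N -> set 'rV[R]_d)
    (b : nat -> 'rV[R]_N) (m n : nat) (x : 'rV[R]_d) : 'rV[R]_d :=
  foldl (fun y k => opQ C (b k) y) x (index_iota m n.+1).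

(* Main.v *)
Require Import Defs.
From mathcomp Require Import all_boot all_order all_algebra.
From mathcomp Require Import all_classical all_reals all_analysis.
From mathcomp Require Import lra.

Import Order.TTheory GRing.Theory Num.Theory.
Import numFieldNormedType.Exports.

Local Open Scope classical_set_scope.
Local Open Scope ring_scope.

(* Q_b fixes C pointwise and is nonexpansive for the Euclidean norm, because
   each Id - P_D is firmly nonexpansive and the weights sum to at most 2. Fix z
   in C. The orbit u_n of x under the Q_(b_n) stays within |x - z| of z, and
   |u - P_D u| <= |u - z| for D among the C_i, so replacing the perturbed
   parameters by the unperturbed ones at step k costs at most
   |x - z| \sum_i |b_k,i - bt_k,i|. Hence u_n is within |x - z| times a tail of
   a convergent series from the unperturbed orbit started at u_m, which
   converges to a point of C. So for every e > 0 some point of C is eventually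
   e-close to u_n: u is Cauchy and its limit lies in the closed set C. *)

(** * Inner product and Euclidean norm *)

Definition dot {R : realType} {d : nat} (u v : 'rV[R]_d) : R :=
  \sum_(k < d) u 0 k * v 0 k.

Section Euclidean.
Context {R : realType} {d : nat}.
Implicit Types (u v w x y z : 'rV[R]_d) (D : set 'rV[R]_d).

Lemma dotC u v : dot u v = dot v u.
Proof. by apply: eq_bigr => k _; rewrite mulrC. Qed.

Lemma dotDl u v w : dot (u + v) w = dot u w + dot v w.
Proof. by rewrite -big_split; apply: eq_bigr => k _; rewrite mxE mulrDl. Qed.

Lemma dotZl a u w : dot (a *: u) w = a * dot u w.
Proof. by rewrite big_distrr; apply: eq_bigr => k _; rewrite mxE /= mulrA. Qed.

Lemma dotDr u v w : dot w (u + v) = dot w u + dot w v.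
Proof. by rewrite dotC dotDl ![dot _ w]dotC. Qed.

Lemma dotZr a u w : dot w (a *: u) = a * dot w u.
Proof. by rewrite dotC dotZl [dot _ w]dotC. Qed.

Lemma dotNl u w : dot (- u) w = - dot u w.
Proof. by rewrite -scaleN1r dotZl mulN1r. Qed.

Lemma dotNr u w : dot w (- u) = - dot w u.
Proof. by rewrite dotC dotNl dotC. Qed.

Definition dotE := (dotDl, dotDr, dotNl, dotNr, dotZl, dotZr).

Lemma dot0l w : dot 0 w = 0.
Proof. by rewrite -(scale0r (0 : 'rV[R]_d)) dotZl mul0r. Qed.

Lemma dot_suml (I : finType) (F : I -> 'rV[R]_d) w :
  dot (\sum_i F i) w = \sum_i dot (F i) w.
Proof.
by apply: (big_morph (dot^~ w)) => [u v|]; [exact: dotDl|exact: dot0l].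
Qed.

Lemma dot_ge0 u : 0 <= dot u u.
Proof. by apply: sumr_ge0 => k _; rewrite -expr2 sqr_ge0. Qed.

Lemma enormE u : enorm u = Num.sqrt (dot u u).
Proof. by congr Num.sqrt; apply: eq_bigr => k _; rewrite expr2. Qed.

Lemma enorm_ge0 u : 0 <= enorm u. Proof. exact: sqrtr_ge0. Qed.

Lemma sqr_enorm u : enorm u ^+ 2 = dot u u.
Proof. by rewrite enormE sqr_sqrtr ?dot_ge0. Qed.

Lemma ler_enorm u v : (enorm u <= enorm v) = (dot u u <= dot v v).
Proof. by rewrite !enormE ler_sqrt ?dot_ge0. Qed.

Lemma enormZ a u : enorm (a *: u) = `|a| * enorm u.
Proof.
by rewrite !enormE !dotE mulrA -expr2 sqrtrM ?sqr_ge0// sqrtr_sqr.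
Qed.

Lemma enorm0 : enorm (0 : 'rV[R]_d) = 0.
Proof. by rewrite enormE dot0l sqrtr0. Qed.

(** Carries Euclidean estimates over to the topology, which is that of the sup norm. *)
Lemma mx_norm_le_enorm u : `|u| <= enorm u.
Proof.
rewrite [leLHS]/Num.Def.normr /= mx_normrE; apply/bigmax_leP.
split => [|[i k] _ /=].
  exact: enorm_ge0.
rewrite (ord1 i) -sqrtr_sqr /enorm ler_sqrt; last first.
  by apply: sumr_ge0 => j _; rewrite sqr_ge0.
rewrite (bigD1 k)//= lerDl; apply: sumr_ge0 => j _; exact: sqr_ge0.
Qed.

Lemma enorm_eq0 u : enorm u = 0 -> u = 0.
Proof.
by move=> u0; apply/eqP; rewrite -normr_le0 -u0 mx_norm_le_enorm.
Qed.

(** Cauchy-Schwarz: expand [0 <= |(|v| u - |u| v)|^2] and cancel the factor [|u| |v|], once null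
    vectors are set aside. *)
Lemma dot_le_enorm u v : dot u v <= enorm u * enorm v.
Proof.
have [u0|un0] := eqVneq (enorm u) 0.
  by rewrite u0 mul0r (enorm_eq0 _ u0) dot0l.
have [v0|vn0] := eqVneq (enorm v) 0.
  by rewrite v0 mulr0 (enorm_eq0 _ v0) dotC dot0l.
have uv0 : 0 < enorm u * enorm v.
  by rewrite mulr_gt0 // lt_neqAle eq_sym ?un0 ?vn0 enorm_ge0.
rewrite -(ler_pM2l uv0).
have := dot_ge0 (enorm v *: u - enorm u *: v).
rewrite !dotE -!sqr_enorm (dotC v u) => h.
lra.
Qed.

Lemma ler_enormD u v : enorm (u + v) <= enorm u + enorm v.
Proof.
rewrite -(@ler_pXn2r _ 2) ?nnegrE ?addr_ge0 ?enorm_ge0//.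
rewrite sqr_enorm !dotE (dotC v u) -!sqr_enorm.
have := dot_le_enorm u v; lra.
Qed.

Lemma ler_enorm_sum (I : finType) (F : I -> 'rV[R]_d) :
  enorm (\sum_i F i) <= \sum_i enorm (F i).
Proof.
elim/big_ind2 : _ => [|u a v b ua vb|//]; first by rewrite enorm0.
by rewrite (le_trans (ler_enormD _ _))// lerD.
Qed.

(** * Nearest points and projections *)

Lemma continuous_enorm_sub x : continuous (fun y => enorm (x - y)).
Proof.
pose coord_sqr k y : R := (x - y) 0 k ^+ 2.
have csqr k : continuous (coord_sqr k).
  have -> : coord_sqr k =
      (fun r => r ^+ 2) \o (fun y : 'rV[R]_d => x 0 k - y 0 k).
    by apply/funext => y; rewrite /coord_sqr !mxE.
  have csub : continuous (fun y : 'rV[R]_d => x 0 k - y 0 k).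
    move=> y; apply: (@cvgB R R^o _ (nbhs y) _ (fun=> x 0 k)
      (fun y : 'rV[R]_d => y 0 k)); first exact: cvg_cst.
    exact: coord_continuous.
  by move=> y; exact: (continuous_comp (csub y) (@exprn_continuous _ 2 _)).
have csum : continuous (fun y => \sum_(k < d) coord_sqr k y).
  by apply: continuous_big => [|k _]; [exact: add_continuous|exact: csqr].
move=> y; apply: (continuous_comp (csum y)); exact: sqrt_continuous.
Qed.

(** By compactness: the points of [D] no farther from [x] than some [z] in [D] form a closed bounded
    set, on which the distance to [x] attains its minimum. *)
Lemma proj_is_nearest D x : closed D -> D !=set0 ->
  is_nearest D x (Defs.proj D x).
Proof.
move=> cD [z Dz]; apply: getPex.
pose A := D `&` [set y | enorm (x - y) <= enorm (x - z)].
have cA : closed A.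
  apply: closedI => //.
  apply: (@preimage_closed _ _ (fun y => enorm (x - y))
      [set r | r <= enorm (x - z)]).
    by move=> y _; exact: continuous_enorm_sub.
  exact: closed_le.
have bA : bounded_set A.
  exists (`|x| + enorm (x - z)); split; first exact: num_real.
  move=> M ltM y [_ /= yA]; apply/ltW/(le_lt_trans _ ltM).
  have -> : y = x - (x - y) by rewrite opprB addrC subrK.
  rewrite (le_trans (ler_normB _ _))// lerD2l.
  exact: le_trans (mx_norm_le_enorm _) yA.
have [||y] := @EVT_min_rV R d (fun y => enorm (x - y)) A _
  (bounded_closed_compact bA cA).
- by exists z; split => /=.
- by apply: continuous_subspaceT; exact: continuous_enorm_sub.
rewrite inE => -[Dy yz] miny; exists y; split => // t Dt.
have [tz|/ltW zt] := leP (enorm (x - t)) (enorm (x - z)).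
  by apply: miny; rewrite inE.
exact: le_trans zt.
Qed.

Lemma proj_id D x : closed D -> D x -> Defs.proj D x = x.
Proof.
move=> cD Dx; have [_ /(_ _ Dx)] := proj_is_nearest _ x cD (ex_intro _ x Dx).
rewrite subrr enorm0 => le0; apply/esym/subr0_eq/enorm_eq0.
by apply/eqP; rewrite eq_le le0 enorm_ge0.
Qed.

(** Moving from [p] towards [z] by a fraction [t] stays in [D], so minimality gives
    [2 <x - p, z - p> <= t |z - p|^2]; then let [t] tend to 0. *)
Lemma is_nearest_obtuse D x p z : convex_set D ->
  is_nearest D x p -> D z -> dot (x - p) (z - p) <= 0.
Proof.
move=> cD [Dp minp] Dz.
have : forall t, 0 <= t -> t <= 1 ->
    dot (x - p) (x - p) <=
      dot ((x - p) - t *: (z - p)) ((x - p) - t *: (z - p)).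
  move=> t t0 t1; rewrite -ler_enorm -addrA -opprD; apply: minp.
  have := cD z p (Itv01 t0 t1); rewrite !inE => /(_ Dz Dp); congr (D _).
  by rewrite /conv /= scalerBl scale1r scalerBr addrCA.
move: (x - p) (z - p) => u v umin; apply/ler_addgt0Pl => e e0; rewrite addr0.
have v0 := dot_ge0 v.
(* This choice ensures both [t <= 1] and [t |v|^2 <= e]. *)
pose t := e / (e + dot v v + 1).
have t0 : 0 < t by apply: divr_gt0 => //; lra.
have t1 : t <= 1 by rewrite ler_pdivrMr; lra.
have tv : t * dot v v <= e by rewrite mulrAC ler_pdivrMr; nra.
have := umin t (ltW t0) t1; rewrite !dotE (dotC v u) => h.
have : t * (2 * dot u v) <= t * (t * dot v v) by lra.
rewrite ler_pM2l//; lra.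
Qed.

Lemma proj_obtuse D x z : closed D -> convex_set D -> D z ->
  dot (x - Defs.proj D x) (z - Defs.proj D x) <= 0.
Proof.
move=> cD vD Dz; apply: (is_nearest_obtuse _ _ _ _ vD) => //.
by apply: proj_is_nearest => //; exists z.
Qed.

(** Let [u] be the difference of the residuals. Adding the obtuse-angle inequalities of [x] against
    [P y] and of [y] against [P x] gives [<u, P x - P y> >= 0], while [x - y = u + (P x - P y)]. *)
Lemma proj_residual_firm D x y : closed D -> convex_set D -> D !=set0 ->
  dot ((x - Defs.proj D x) - (y - Defs.proj D y))
      ((x - Defs.proj D x) - (y - Defs.proj D y))
    <= dot ((x - Defs.proj D x) - (y - Defs.proj D y)) (x - y).
Proof.
move=> cD vD D0; set u := _ - _ - _.
have [Dx _] := proj_is_nearest _ x cD D0.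
have [Dy _] := proj_is_nearest _ y cD D0.
have := proj_obtuse _ x _ cD vD Dy; have := proj_obtuse _ y _ cD vD Dx.
have -> : x - y = u + (Defs.proj D x - Defs.proj D y).
  by rewrite /u opprB addrACA subrK [_ - y - _]addrAC subrr sub0r.
rewrite /u -(opprB (Defs.proj D y) (Defs.proj D x)).
move: (x - _) (y - _) (Defs.proj D y - _) => a b c.
by rewrite !dotE; lra.
Qed.

(* With s the sum, summing 2 <u j, v> <= |u j|^2 + |v|^2 with weights a j at
   v = s / 2 gives |s|^2 <= 2 \sum_j a j |u j|^2 <= 2 <s, w>. *)
Lemma enorm_relaxation_le (N : nat) (a : 'I_N -> R) (u : 'I_N -> 'rV[R]_d) w :
  (forall j, 0 <= a j) -> \sum_j a j <= 2 ->
  (forall j, dot (u j) (u j) <= dot (u j) w) ->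
  enorm (w - \sum_j a j *: u j) <= enorm w.
Proof.
move=> a0 a2 uw; set s := \sum_j a j *: u j.
set q := \sum_j a j * dot (u j) (u j).
have sw : q <= dot s w.
  rewrite /s dot_suml; apply: ler_sum => j _.
  by rewrite dotZl ler_wpM2l.
have us j v : 2 * dot (u j) v <= dot (u j) (u j) + dot v v.
  by have := dot_ge0 (u j - v); rewrite !dotE (dotC v); lra.
have ss : dot s s <= 2 * q.
  have half v : 2 * dot s v <= q + 2 * dot v v.
    rewrite {1}/s dot_suml mulr_sumr.
    apply: (@le_trans _ _ (\sum_j (a j * dot (u j) (u j) + a j * dot v v))).
      apply: ler_sum => j _; rewrite dotZl mulrCA -mulrDr.
      by rewrite ler_wpM2l.
    by rewrite big_split /= -mulr_suml lerD2l ler_wpM2r ?dot_ge0.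
  by have := half (2^-1 *: s); rewrite !dotE; lra.
rewrite ler_enorm !dotE (dotC w s); lra.
Qed.

(** * The operators [Q_b] and their products *)

Section Relaxation.
Context {N : nat} (C : 'I_N -> set 'rV[R]_d).
Hypotheses (C_closed : forall i, closed (C i))
  (C_convex : forall i, convex_set (C i)).
Variable z : 'rV[R]_d.
Hypothesis Cz : forall i, C i z.

Lemma opQ_nonexpansive b x y : paramB b ->
  enorm (opQ C b x - opQ C b y) <= enorm (x - y).
Proof.
move=> [b0 b2].
have -> : opQ C b x - opQ C b y = x - y - \sum_j b 0 j *:
    ((x - Defs.proj (C j) x) - (y - Defs.proj (C j) y)).
  rewrite /opQ opprD addrACA -opprD -sumrB; congr (_ - _).
  by apply: eq_bigr => j _; rewrite [RHS]scalerBr.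
apply: enorm_relaxation_le => // j; apply: proj_residual_firm => //.
by exists z.
Qed.

Lemma opQ_fixed b : opQ C b z = z.
Proof.
by rewrite /opQ big1 ?subr0// => j _; rewrite proj_id// subrr scaler0.
Qed.

(** Since [z] lies in every [C j], each residual [x - P x] is at most [|x - z|] long. *)
Lemma opQ_param_lipschitz b b' x :
  enorm (opQ C b x - opQ C b' x) <=
  (\sum_(j < N) `|b 0 j - b' 0 j|) * enorm (x - z).
Proof.
have -> : opQ C b x - opQ C b' x =
    \sum_j (b' 0 j - b 0 j) *: (x - Defs.proj (C j) x).
  rewrite /opQ opprB addrC subrKA -sumrB.
  by apply: eq_bigr => j _; rewrite scalerBl.
rewrite (le_trans (ler_enorm_sum _ _))// mulr_suml; apply: ler_sum => j _.
rewrite enormZ distrC ler_wpM2l//.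
have [|_] := proj_is_nearest (C j) x (C_closed j); first by exists z.
exact.
Qed.

Lemma prodQ_id b m n x : (n < m)%N -> prodQ C b m n x = x.
Proof.
by move=> nm; rewrite /prodQ /index_iota (_ : (n.+1 - m)%N = 0)//; apply/eqP.
Qed.

Lemma prodQ_recr b m n x : (m <= n.+1)%N ->
  prodQ C b m n.+1 x = opQ C (b n.+1) (prodQ C b m n x).
Proof.
move=> mn; rewrite /prodQ /index_iota subSn//.
by rewrite -[(_ - _).+1]addn1 iotaD subnKC// foldl_cat.
Qed.

Lemma prodQ_fejer b m n x : (forall k, (m <= k)%N -> paramB (b k)) ->
  enorm (prodQ C b m n x - z) <= enorm (x - z).
Proof.
move=> bP; elim: n => [|n IH].
  (* With [m = 0] the product up to [n = 0] already has one factor, [opQ C (b 0)]. *)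
  case: m bP => [bP|m _]; last by rewrite prodQ_id.
  rewrite -{1}(opQ_fixed (b 0%N)); apply: opQ_nonexpansive; exact: bP.
have [nm|mn] := ltnP n.+1 m; first by rewrite prodQ_id.
rewrite prodQ_recr// -{1}(opQ_fixed (b n.+1)).
exact: le_trans (opQ_nonexpansive _ _ _ (bP _ mn)) IH.
Qed.

(** Both orbits agree at time [m]; each later step adds one parameter error, bounded uniformly
    thanks to [prodQ_fejer], and does not enlarge the earlier ones. *)
Lemma prodQ_perturbation b b' m n x :
  (forall k, (1 <= k)%N -> paramB (b k)) ->
  (forall k, (1 <= k)%N -> paramB (b' k)) -> (m <= n)%N ->
  enorm (prodQ C b 1 n x - prodQ C b' m.+1 n (prodQ C b 1 m x)) <=
  (\sum_(m.+1 <= k < n.+1) \sum_(j < N) `|b k 0 j - b' k 0 j|) *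
    enorm (x - z).
Proof.
move=> bP b'P; elim: n => [|n IH].
  by rewrite leqn0 => /eqP->; rewrite !prodQ_id// subrr enorm0 big_geq ?mul0r.
rewrite leq_eqVlt => /orP[/eqP<-|mn].
  by rewrite [prodQ C b' _ _ _]prodQ_id// subrr enorm0 big_geq ?mul0r.
rewrite big_nat_recr//= 2?prodQ_recr//.
set u := prodQ C b 1 n x; set v := prodQ C b' m.+1 n _.
(* The intermediate point applies the unperturbed operator to the perturbed orbit. *)
rewrite -(subrKA (opQ C (b' n.+1) u)) (le_trans (ler_enormD _ _))//.
rewrite addrC mulrDl lerD//.
  apply: le_trans (opQ_param_lipschitz _ _ _) _.
  by rewrite ler_wpM2l ?sumr_ge0// prodQ_fejer.
exact: le_trans (opQ_nonexpansive _ _ _ (b'P n.+1 isT)) (IH mn).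
Qed.

End Relaxation.
End Euclidean.

(** * Tails of the series and convergence *)

Lemma summable_tail_lt (R : realType) (f : nat -> R) (e : R) :
  (forall k, 0 <= f k) -> (\sum_(1 <= k <oo) (f k)%:E < +oo)%E -> 0 < e ->
  exists m, forall n, \sum_(m.+1 <= k < n) f k < e.
Proof.
move=> f0 foo e0.
move: foo; rewrite eseries_cond => /nneseries_tail_cvg tail.
have /(_ [set x | (x < e%:E)%E]) := tail (fun k _ => f0 k : (0 <= (f k)%:E)%E).
case=> [|m _ /(_ m.+1 (leqnSn m)) /= tailm].
  by apply: open_ereal_lt'; rewrite lte_fin.
exists m => n; rewrite -lte_fin -sumEFin; apply: le_lt_trans tailm.
(* The filter [1 <= k], which encodes the starting index of the series, holds automatically from
   [m.+1] on. *)
have -> : (\sum_(m.+1 <= k < n) (f k)%:E =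
           \sum_(m.+1 <= k < n | (1 <= k)%N) (f k)%:E)%E.
  rewrite [LHS]big_nat_cond [RHS]big_nat_cond; apply: eq_bigl => k.
  by case: k => [|k] //=; rewrite !andbF.
by apply: nneseries_lim_ge => k _ _; rewrite lee_fin.
Qed.

Theorem proposition2 (R : realType) (d N : nat) (C : 'I_N -> set 'rV[R]_d)
  (C_closed : forall i, closed (C i))
  (C_convex : forall i, convex_set (C i))
  (C_meet : \bigcap_(i in [set: 'I_N]) C i !=set0)
  (bt : nat -> 'rV[R]_N)
  (bt_param : forall n, (1 <= n)%N -> paramB (bt n))
  (bt_cvg : forall (m : nat) (x : 'rV[R]_d), (1 <= m)%N ->
     exists2 y, (\bigcap_(i in [set: 'I_N]) C i) y &
       (fun n => prodQ C bt m n x) @ \oo --> y)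
  (b : nat -> 'rV[R]_N)
  (b_param : forall n, (1 <= n)%N -> paramB (b n))
  (b_near : (\sum_(1 <= n <oo)
     (\sum_(i < N) `|b n 0 i - bt n 0 i|)%:E < +oo)%E) :
  forall x : 'rV[R]_d,
    exists2 y, (\bigcap_(i in [set: 'I_N]) C i) y &
      (fun n => prodQ C b 1 n x) @ \oo --> y.
Proof.
move=> x; have [z Cz] := C_meet.
have Ciz i : C i z by exact: Cz.
set u := fun n => prodQ C b 1 n x.
have near_C e : 0 < e ->
    exists2 y, (\bigcap_(i in [set: 'I_N]) C i) y &
      \forall n \near \oo, ball y e (u n).
  move=> e0.
  (* The added 1 keeps the divisor positive even when [x = z]. *)
  have M0 : 0 < enorm (x - z) + 1 by rewrite ltr_wpDl// enorm_ge0.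
  have e1 : 0 < e / 2 / (enorm (x - z) + 1) by rewrite !divr_gt0.
  have [m tailm] := summable_tail_lt _ _ _
    (fun k => sumr_ge0 _ (fun i _ => normr_ge0 _)) b_near e1.
  have [y Cy vy] := bt_cvg m.+1 (u m) isT.
  exists y => //; rewrite -ball_normE /ball_ /=.
  near=> n.
  (* Half of [e] goes to the convergence of the unperturbed orbit restarted at [u m], half to the
     tail of the perturbations. *)
  rewrite -(subrKA (prodQ C bt m.+1 n (u m))) (splitr e).
  rewrite (le_lt_trans (ler_normD _ _))// ltrD//.
    near: n; apply: cvgr_dist_lt => //; exact: divr_gt0.
  rewrite distrC (le_lt_trans (mx_norm_le_enorm _))//.
  apply: (le_lt_trans (prodQ_perturbation C C_closed C_convex z Ciz _ _ _ _ _
    b_param bt_param _)).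
    by near: n; exact: nbhs_infty_ge.
  have := tailm n.+1; rewrite ltr_pdivlMr// => h; apply: le_lt_trans h.
  by rewrite ler_wpM2l ?lerDl// sumr_ge0// => k _; rewrite sumr_ge0.
(* The centre [y] may depend on [e]: one ball of each radius that eventually contains [u] is
   enough. *)
have /cauchy_cvg/cvg_ex[l ul] : cauchy (u @ \oo).
  apply: cauchy_exP => e e0; have [y _ yu] := near_C e e0.
  by exists y.
exists l => //; apply: (closed_bigI (fun i _ => C_closed i)).
move=> B /nbhs_ballP[e e0 eB].
have e20 : 0 < e / 2 by exact: divr_gt0.
have [y Cy yu] := near_C _ e20.
exists y; split=> //; apply: eB.
have /cvg_ballP/(_ _ e20) lu := ul.
(* A single [u n] within [e / 2] of both [l] and [y] puts the point [y] of the intersection within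
   [e] of [l]. *)
have [n [? ?]] := filter_ex (filterI lu yu).
exact: (@ball_splitl _ _ (u n)).
Unshelve. all: by end_near.
Qed.
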